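(* Let $n$ be an odd number and $h_n:=\frac{n-1}{2}$. Let $m\ge 0$ and $\beta\ge 1$ be integers such that $m+\beta\le h_n$. Let $s,x\in\mathbb{R}^{n+1}$ with $s\notin[x]$, and let $\overline{D}$ and $\Delta_{n+1}$ be the conjugate Dirac and Laplace operators applied with respect to the variable $x$. (i) If $\beta=2k_1+1$, where $k_1\ge 0$ is an integer, then $$\overline{D}^{\beta}\left(\Delta_{n+1}^m S_L^{-1}(s,x)\right)=2^{\beta}4^m(-h_n)_m\left((s-\bar x)\sum_{j=0}^{k_1}\mathbf{a}^1_{j,k_1,m}\,\mathcal{Q}_{c,s}^{-m-j-2-k_1}(x)(s-x_0)^{2j+1}+\sum_{j=0}^{k_1}\mathbf{b}^1_{j,k_1,m}\,\mathcal{Q}_{c,s}^{-m-1-k_1-j}(x)(s-x_0)^{2j}\right),$$ where $$\mathbf{a}^1_{j,k_1,m}:=2^{2j+1}(m+k_1+1+j)!\,(k_1-j)!\binom{k_1+j+1}{2j+1}\binom{h_n-m-k_1-j-2}{h_n-m-2k_1-2},$$ $$\mathbf{b}^1_{j,k_1,m}:=2^{2j}(k_1-j+1)!\,(m+k_1+j)!\binom{h_n-m-k_1-j-1}{h_n-m-2k_1-2}\binom{k_1+j}{2j}.$$ (ii) If $\beta=2k_2$, where $k_2\ge 1$ is an integer, then $$\overline{D}^{\beta}\left(\Delta_{n+1}^m S_L^{-1}(s,x)\right)=2^{\beta}4^m(-h_n)_m\left((s-\bar x)\sum_{j=0}^{k_2}\mathbf{a}^2_{j,k_2,m}\,\mathcal{Q}_{c,s}^{-m-j-1-k_2}(x)(s-x_0)^{2j}+\sum_{j=0}^{k_2-1}\mathbf{b}^2_{j,k_2,m}\,\mathcal{Q}_{c,s}^{-m-1-k_2-j}(x)(s-x_0)^{2j+1}\right),$$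 where $$\mathbf{a}^2_{j,k_2,m}:=2^{2j}(m+k_2+j)!\,(k_2-j)!\binom{k_2+j}{2j}\binom{h_n-m-k_2-1-j}{h_n-m-2k_2-1},$$ $$\mathbf{b}^2_{j,k_2,m}:=2^{2j+1}(k_2-j)!\,(m+k_2+j)!\binom{h_n-m-k_2-1-j}{h_n-m-2k_2-1}\binom{k_2+j}{2j+1}.$$
   Context: $\mathbb{R}_n$ is the real Clifford algebra generated by $e_1,\dots,e_n$ with $e_ie_j+e_je_i=-2\delta_{ij}$. A point $(x_0,\dots,x_n)\in\mathbb{R}^{n+1}$ is identified with the paravector $x=x_0+\underline{x}\in\mathbb{R}_n$, $\underline{x}=\sum_{i=1}^n x_ie_i$; its conjugate is $\bar x=x_0-\underline{x}$ and $|x|^2=x_0^2+\dots+x_n^2$. $\mathbb{S}$ is the set of $1$-vectors $\underline{x}$ with $x_1^2+\dots+x_n^2=1$, and $[x]:=\{x_0+J|\underline{x}| : J\in\mathbb{S}\}$. For $s,x\in\mathbb{R}^{n+1}$, $\mathcal{Q}_{c,s}(x):=s^2-2x_0s+|x|^2$; it is invertible in $\mathbb{R}_n$ when $s\notin[x]$ (equivalently $x\notin[s]$), and $\mathcal{Q}_{c,s}^{-\ell}(x):=(\mathcal{Q}_{c,s}(x)^{-1})^{\ell}$ for integers $\ell\ge0$. The left slice hyperholomorphic Cauchy kernel is (in its second form) $S_L^{-1}(s,x)=(s-\bar x)\mathcal{Q}_{c,s}^{-1}(x)$. The conjugate Dirac operator acts on $\mathbb{R}_n$-valued functions of $x$ from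 the left: $\overline{D}f=\partial_{x_0}f-\sum_{i=1}^n e_i\partial_{x_i}f$. $\Delta_{n+1}=\sum_{i=0}^n\partial_{x_i}^2$ is the Laplacian in the $n+1$ variables. Powers of operators denote iteration. For integers $0\le m\le h_n$: $(-h_n)_m=(-1)^m\frac{h_n!}{(h_n-m)!}$. Convention $(s-x_0)^0=1$. Binomial coefficients: for integers $p\ge q$ (with $q$ possibly negative), $\binom{p}{q}:=\frac{1}{(p-q)!}\prod_{\ell=1}^{p-q}(q+\ell)$, which is the usual binomial coefficient when $q\ge0$; in particular $\binom{-1}{-1}=1$ and $\binom{p}{-1}=0$ for $p\ge0$. *)

(* Defs.v *)
From HB Require Import structures.
From mathcomp Require Import all_boot all_order all_algebra.
From mathcomp Require Import boolp classical_sets reals topology normedtype.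
From mathcomp Require Import derive.
From mathcomp Require Import ring.

Set Implicit Arguments.
Unset Strict Implicit.
Unset Printing Implicit Defensive.

Import Order.TTheory GRing.Theory Num.Theory.
Import numFieldNormedType.Exports.

Local Open Scope ring_scope.

Definition symdiff (T : finType) (A B : {set T}) : {set T} :=
  (A :\: B) :|: (B :\: A).

Section SymDiff.
Context {T : finType}.
Implicit Types A B C : {set T}.

Lemma in_symdiff A B i : (i \in symdiff A B) = (i \in A) (+) (i \in B).
Proof. by rewrite !inE; case: (i \in A); case: (i \in B). Qed.

Lemma symdiffC A B : symdiff A B = symdiff B A.
Proof. by apply/setP=> i; rewrite !in_symdiff addbC. Qed.

Lemma symdiffA A B C : symdiff A (symdiff B C) = symdiff (symdiff A B) C.
Proof. by apply/setP=> i; rewrite !in_symdiff addbA. Qed.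

Lemma symdiff0s A : symdiff finset.set0 A = A.
Proof. by apply/setP=> i; rewrite in_symdiff inE. Qed.

Lemma symdiffK A B : symdiff A (symdiff A B) = B.
Proof. by apply/setP=> i; rewrite !in_symdiff addKb. Qed.

Lemma symdiffss A : symdiff A A = finset.set0.
Proof. by apply/setP=> i; rewrite in_symdiff inE addbb. Qed.

End SymDiff.

(* An element is given by its coordinates in the basis of the e_A, where
   e_A is the product of the e_i, i in A, taken in increasing order
   (see [blade_prod] below). *)
Definition clifford (R : Type) (n : nat) : Type := {ffun {set 'I_n} -> R}.

HB.instance Definition _ (R : comNzRingType) n :=
  GRing.Lmodule.copy (clifford R n) {ffun {set 'I_n} -> R^o}.

(* e_A e_B = cl_sign A B e_(A symdiff B): a factor -1 for each e_i (i in A)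
   that has to move past e_j (j in B, j < i), and one for each e_i e_i = -1. *)
Definition cl_sign (R : comNzRingType) n (A B : {set 'I_n}) : R :=
  \prod_(i in A) \prod_(j in B) (-1) ^+ (j <= i)%N.

Definition cl_one (R : comNzRingType) n : clifford R n :=
  [ffun A : {set 'I_n} => (A == finset.set0)%:R].

Definition cl_mul (R : comNzRingType) n (a b : clifford R n) : clifford R n :=
  [ffun C : {set 'I_n} =>
     \sum_(A : {set 'I_n}) cl_sign R A (symdiff A C) * (a A * b (symdiff A C))].

Section CliffordRing.
Variables (R : comNzRingType) (n : nat).
Implicit Types (A B C : {set 'I_n}) (a b c : clifford R n).

Local Notation sg A B := (cl_sign R A B).

Let prod_symdiff (F : 'I_n -> R) A B : (forall i, F i * F i = 1) ->
  \prod_(i in symdiff A B) F i = (\prod_(i in A) F i) * \prod_(i in B) F i.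
Proof.
move=> F2; rewrite ![\prod_(i in _) _]big_mkcond -big_split /=.
apply: eq_bigr => i _; rewrite in_symdiff.
by case: (i \in A); case: (i \in B); rewrite /= ?mulr1 ?mul1r ?F2.
Qed.

Let sq_prod (P : pred 'I_n) (F : 'I_n -> R) : (forall i, F i * F i = 1) ->
  (\prod_(i | P i) F i) * (\prod_(i | P i) F i) = 1.
Proof. by move=> F2; rewrite -big_split /= big1. Qed.

Let sq_sign (e : bool) : (-1) ^+ e * (-1) ^+ e = 1 :> R.
Proof. by rewrite -signr_addb addbb. Qed.

Lemma cl_signDl A B C : sg (symdiff A B) C = sg A C * sg B C.
Proof. by rewrite /cl_sign prod_symdiff // => i; apply: sq_prod. Qed.

Lemma cl_signDr A B C : sg A (symdiff B C) = sg A B * sg A C.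
Proof.
rewrite /cl_sign -big_split /=; apply: eq_bigr => i _.
by rewrite prod_symdiff.
Qed.

Lemma cl_sign0l A : sg finset.set0 A = 1.
Proof. by rewrite /cl_sign big_set0. Qed.

Lemma cl_sign0r A : sg A finset.set0 = 1.
Proof. by rewrite /cl_sign big1 // => i _; rewrite big_set0. Qed.

Let reindex_symdiff A (F : {set 'I_n} -> R) :
  \sum_B F B = \sum_B F (symdiff A B).
Proof.
by apply: reindex; exists (symdiff A) => B _; apply: symdiffK.
Qed.

Lemma cl_mulA : associative (@cl_mul R n).
Proof.
move=> a b c; apply/ffunP => D; rewrite !ffunE; symmetry.
under eq_bigr => E _ do rewrite ffunE mulrC -mulrA big_distrl /=.
rewrite exchange_big /=; apply: eq_bigr => A _.
rewrite ffunE mulrA big_distrr /= (reindex_symdiff A); apply: eq_bigr => B _.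
rewrite symdiffK -symdiffA cl_signDl.
have -> : symdiff A (symdiff B D) = symdiff B (symdiff A D).
  by rewrite !symdiffA (symdiffC A).
rewrite [in RHS](_ : symdiff A D = symdiff B (symdiff B (symdiff A D))).
  2: by rewrite symdiffK.
rewrite [in X in _ = X * _]cl_signDr symdiffK.
ring.
Qed.

Lemma cl_mul1l : left_id (@cl_one R n) (@cl_mul R n).
Proof.
move=> a; apply/ffunP => C; rewrite !ffunE (bigD1 finset.set0) //= big1.
  by rewrite symdiff0s cl_sign0l ffunE eqxx !mul1r addr0.
by move=> A /negPf A0; rewrite ffunE A0 mul0r mulr0.
Qed.

Lemma cl_mul1r : right_id (@cl_one R n) (@cl_mul R n).
Proof.
move=> a; apply/ffunP => C; rewrite !ffunE (bigD1 C) //= big1.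
  by rewrite symdiffss cl_sign0r ffunE eqxx mul1r mulr1 addr0.
move=> A AC; rewrite ffunE; case: eqP => [E|]; last by rewrite !mulr0.
by move: AC; rewrite -(symdiffK A C) E symdiffC symdiff0s eqxx.
Qed.

Lemma cl_mulDl : left_distributive (@cl_mul R n) +%R.
Proof.
move=> a b c; apply/ffunP => C; rewrite !ffunE -big_split /=.
by apply: eq_bigr => A _; rewrite ffunE mulrDl mulrDr.
Qed.

Lemma cl_mulDr : right_distributive (@cl_mul R n) +%R.
Proof.
move=> a b c; apply/ffunP => C; rewrite !ffunE -big_split /=.
by apply: eq_bigr => A _; rewrite ffunE !mulrDr.
Qed.

Lemma cl_one_neq0 : @cl_one R n != 0.
Proof.
apply/eqP => /ffunP /(_ finset.set0); rewrite !ffunE eqxx.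
by move/eqP; rewrite oner_eq0.
Qed.

HB.instance Definition _ := GRing.Zmodule_isNzRing.Build (clifford R n)
  cl_mulA cl_mul1l cl_mul1r cl_mulDl cl_mulDr cl_one_neq0.

Lemma cl_scaleAl (k : R) a b : k *: (a * b) = (k *: a) * b.
Proof.
apply/ffunP => C; rewrite !ffunE /GRing.scale /= mulr_sumr.
by apply: eq_bigr => A _; rewrite ffunE /GRing.scale /= -mulrA mulrCA.
Qed.

HB.instance Definition _ :=
  GRing.Lmodule_isLalgebra.Build R (clifford R n) cl_scaleAl.

Lemma cl_scaleAr (k : R) a b : k *: (a * b) = a * (k *: b).
Proof.
apply/ffunP => C; rewrite !ffunE /GRing.scale /= mulr_sumr.
apply: eq_bigr => A _; rewrite ffunE /GRing.scale /=.
by rewrite mulrCA; congr (_ * _); rewrite mulrCA.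
Qed.

HB.instance Definition _ :=
  GRing.Lalgebra_isAlgebra.Build R (clifford R n) cl_scaleAr.

Definition cl_unit : pred (clifford R n) :=
  fun a => `[< exists b, b * a = 1 /\ a * b = 1 >].

Definition cl_inv a : clifford R n :=
  xget a [set b | b * a = 1 /\ a * b = 1]%classic.

Let cl_invP a : a \in cl_unit -> cl_inv a * a = 1 /\ a * cl_inv a = 1.
Proof.
by move=> /asboolP ab; rewrite /cl_inv; case: xgetP => [b _ //|nb];
   case: ab => b /nb.
Qed.

Let cl_mulVr : {in cl_unit, left_inverse 1 cl_inv *%R}.
Proof. by move=> a /cl_invP[]. Qed.

Let cl_divrr : {in cl_unit, right_inverse 1 cl_inv *%R}.
Proof. by move=> a /cl_invP[]. Qed.

Let cl_unitP a b : b * a = 1 /\ a * b = 1 -> cl_unit a.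
Proof. by move=> ab; apply/asboolP; exists b. Qed.

Let cl_inv_out : {in [predC cl_unit], cl_inv =1 id}.
Proof.
move=> a /asboolPn na; rewrite /cl_inv; case: xgetP => // b _ ab.
by case: na; exists b.
Qed.

HB.instance Definition _ := GRing.NzRing_hasMulInverse.Build (clifford R n)
  cl_mulVr cl_divrr cl_unitP cl_inv_out.

End CliffordRing.

Section Generators.
Variables (R : comNzRingType) (n : nat).
Implicit Types (A B C : {set 'I_n}) (i j : 'I_n).

Definition blade A : clifford R n := [ffun B => (B == A)%:R].

Definition cl_gen i : clifford R n := blade [set i]%SET.

Lemma blade_mul A B :
  blade A * blade B = cl_sign R A B *: blade (symdiff A B).
Proof.
apply/ffunP => C; rewrite !ffunE /GRing.scale /= (bigD1 A) //= big1 ?addr0.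
  rewrite !ffunE eqxx mul1r (can2_eq (symdiffK A) (symdiffK A)).
  case: eqP => [->|_]; last by rewrite !mulr0.
  by rewrite symdiffK.
by move=> D /negPf DA; rewrite ffunE DA mul0r mulr0.
Qed.

Lemma cl_genM i j :
  cl_gen i * cl_gen j + cl_gen j * cl_gen i = - ((i == j)%:R *+ 2).
Proof.
rewrite /cl_gen !blade_mul (symdiffC [set j]%SET) -scalerDl.
rewrite /cl_sign !big_set1; case: eqVneq => [->|ij].
  rewrite leqnn symdiffss scalerDl scaleN1r -mulr2n mulNrn.
  by congr (- (_ *+ 2)).
rewrite mul0rn oppr0; case: ltngtP => [_|_|/val_inj e] /=.
- by rewrite ?expr0 ?expr1 ?addrN ?addNr scale0r.
- by rewrite ?expr0 ?expr1 ?addrN ?addNr scale0r.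
- by rewrite e eqxx in ij.
Qed.

Lemma blade_prod A : blade A = \prod_(i <- enum A) cl_gen i.
Proof.
have H (s : seq 'I_n) : sorted (fun i j : 'I_n => i < j)%N s ->
    \prod_(i <- s) cl_gen i = blade [set i in s]%SET.
  elim: s => [_|i s IHs /= ps].
    rewrite big_nil; apply/ffunP => B; rewrite !ffunE.
    by congr (_ == _)%:R; apply/setP => j; rewrite !inE.
  rewrite big_cons IHs ?(path_sorted ps) // /cl_gen blade_mul.
  have lt_i j : j \in s -> (i < j)%N.
    move: ps; rewrite path_sortedE; last by move=> ? ? ? ; apply: ltn_trans.
    by case/andP => /allP is_lt _; apply: is_lt.
  rewrite /cl_sign big_set1 big1 ?scale1r; last first.
    by move=> j; rewrite inE => /lt_i; rewrite ltnNge => /negPf->.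
  congr blade; apply/setP => j; rewrite in_symdiff !inE.
  by case: eqVneq => [->|//]; apply/negP => /lt_i; rewrite ltnn.
rewrite H; first by congr blade; apply/setP => i; rewrite inE mem_enum.
rewrite /(enum _) -enumT sorted_filter //=.
  by move=> j i k; apply: ltn_trans.
by have := iota_ltn_sorted 0 n; rewrite -val_enum_ord sorted_map.
Qed.

Lemma cl_expand (a : clifford R n) : a = \sum_A a A *: blade A.
Proof.
apply/ffunP => C; rewrite sum_ffunE (bigD1 C) //= big1 ?addr0.
  by rewrite !ffunE eqxx /GRing.scale /= mulr1.
by move=> A CA; rewrite !ffunE eq_sym (negPf CA) /GRing.scale /= mulr0.
Qed.

End Generators.

Section SliceHyperholomorphic.
Variables (R : realType) (n : nat).
Implicit Types (s x : 'rV[R]_n.+1) (f : 'rV[R]_n.+1 -> clifford R n).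

Definition one_vector (u : 'rV[R]_n) : clifford R n :=
  \sum_(i < n) u 0 i *: cl_gen R i.

Definition vec_part x : 'rV[R]_n := \row_(i < n) x 0 (lift ord0 i).

Definition paravector x : clifford R n := (x 0 0)%:A + one_vector (vec_part x).

Definition paravector_conj x : clifford R n :=
  (x 0 0)%:A - one_vector (vec_part x).

(* The canonical norm on 'rV[R]_m is the sup norm, hence this definition. *)
Definition sqnorm m (u : 'rV[R]_m) : R := \sum_(i < m) u 0 i ^+ 2.

Definition unit_sphere : set (clifford R n) :=
  [set J | exists2 u : 'rV[R]_n, J = one_vector u & sqnorm u = 1]%classic.

Definition sphere_of x : set (clifford R n) :=
  [set (x 0 0)%:A + Num.sqrt (sqnorm (vec_part x)) *: J
     | J in unit_sphere]%classic.

Definition Qc s x : clifford R n :=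
  paravector s ^+ 2 - (2 * x 0 0) *: paravector s + (sqnorm x)%:A.

Definition Qc_inv_exp s x (l : nat) : clifford R n := (Qc s x)^-1 ^+ l.

Definition SL_inv s x : clifford R n :=
  (paravector s - paravector_conj x) * (Qc s x)^-1.

(* Partial derivatives are taken coordinatewise in the basis e_A. *)
Definition partial (i : 'I_n.+1) f : 'rV[R]_n.+1 -> clifford R n :=
  fun x => [ffun A => 'D_(delta_mx 0 i) (fun y => f y A) x].

Definition conj_dirac f : 'rV[R]_n.+1 -> clifford R n :=
  fun x => partial ord0 f x
           - \sum_(i < n) cl_gen R i * partial (lift ord0 i) f x.

Definition laplacian f : 'rV[R]_n.+1 -> clifford R n :=
  fun x => \sum_(i < n.+1) partial i (partial i f) x.

End SliceHyperholomorphic.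

Section Coefficients.
Variable R : realType.

(* The Pochhammer symbol (-h)_m, for m <= h. *)
Definition poch_neg (h m : nat) : R := (-1) ^+ m * (h`!%:R / (h - m)`!%:R).

(* Only meaningful for q <= p, where `|p - q| is p - q; q may be negative. *)
Definition binz (p q : int) : R :=
  (`|p - q|%N)`!%:R^-1 * \prod_(1 <= l < `|p - q|.+1) (q + l%:Z)%:~R.

Lemma binz_nat (p q : nat) : (q <= p)%N -> binz p%:Z q%:Z = 'C(p, q)%:R.
Proof.
move=> qp; rewrite /binz subzn // absz_nat.
have -> : \prod_(1 <= l < (p - q).+1) (q%:Z + l%:Z)%:~R
    = (p`!%:R / q`!%:R) :> R.
  rewrite -{2}(subnK qp); elim: (p - q)%N => [|k IHk].
    by rewrite big_geq // add0n divff // pnatr_eq0 -lt0n fact_gt0.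
  rewrite big_nat_recr //= IHk addSn factS natrM -PoszD -pmulrn.
  by rewrite addnS (addnC q) mulrAC [_ * _.+1%:R]mulrC.
rewrite -(bin_fact qp) !natrM mulrA; set a := (q`!)%:R; set b := _`!%:R.
have a0 : a != 0 :> R by rewrite pnatr_eq0 -lt0n fact_gt0.
have b0 : b != 0 :> R by rewrite pnatr_eq0 -lt0n fact_gt0.
by field; rewrite a0 b0.
Qed.

Variables (h m : nat).

Definition coef_a1 (k j : nat) : R :=
  2 ^+ (2 * j + 1) * (m + k + 1 + j)`!%:R * (k - j)`!%:R
  * binz (k + j + 1)%N (2 * j + 1)%N
  * binz (h%:Z - m%:Z - k%:Z - j%:Z - 2) (h%:Z - m%:Z - 2 * k%:Z - 2).

Definition coef_b1 (k j : nat) : R :=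
  2 ^+ (2 * j) * (k - j + 1)`!%:R * (m + k + j)`!%:R
  * binz (h%:Z - m%:Z - k%:Z - j%:Z - 1) (h%:Z - m%:Z - 2 * k%:Z - 2)
  * binz (k + j)%N (2 * j)%N.

Definition coef_a2 (k j : nat) : R :=
  2 ^+ (2 * j) * (m + k + j)`!%:R * (k - j)`!%:R
  * binz (k + j)%N (2 * j)%N
  * binz (h%:Z - m%:Z - k%:Z - 1 - j%:Z) (h%:Z - m%:Z - 2 * k%:Z - 1).

Definition coef_b2 (k j : nat) : R :=
  2 ^+ (2 * j + 1) * (k - j)`!%:R * (m + k + j)`!%:R
  * binz (h%:Z - m%:Z - k%:Z - 1 - j%:Z) (h%:Z - m%:Z - 2 * k%:Z - 1)
  * binz (k + j)%N (2 * j + 1)%N.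

End Coefficients.

(* Main.v *)
(* Put sigma = s - x_0, v = \underline{x}, Q = Q_{c,s}(x) = sigma^2 + |v|^2 and
     T(p,l) = Q^{-l} sigma^p,  S(p,l) = (s - \bar x) T(p,l) = (sigma + v) T(p,l).
   Since sigma commutes with Q and v^2 = sigma^2 - Q, these two families are
   stable under the operators: with n = 2h + 1,
     \bar D T(p,l) = 2l S(p,l+1) - p T(p-1,l),
     \bar D S(p,l) = 4l S(p+1,l+1) - p S(p-1,l) + 2(h-l) T(p,l),
     \Delta S(0,l) = 4l(l-1-h) S(0,l+1).
   Hence \Delta^m S(0,1) = 4^m m! (-h)_m S(0,m+1), and the coefficients of
   \bar D^\beta S(0,m+1) obey linear recurrences, which become Pascal's rule
   once the coefficients are written with binomial coefficients and falling
   factorials.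
   The points where Q is invertible form an open set, because Q is a unit
   as soon as a real polynomial in x does not vanish; so all derivatives can
   be iterated there. *)

Require Import Defs.
From mathcomp Require Import all_boot all_order all_algebra.
From mathcomp Require Import boolp classical_sets reals topology normedtype.
From mathcomp Require Import derive ring zify.

Set Implicit Arguments.
Unset Strict Implicit.
Unset Printing Implicit Defensive.

Import Order.TTheory GRing.Theory Num.Theory.
Import numFieldNormedType.Exports.

Local Open Scope ring_scope.

(** * Inverting Q_{c,s}(x) in the Clifford algebra *)

Section CliffordAlgebra.
Variables (R : realType) (n : nat).
Implicit Types (u : 'rV[R]_n) (s x : 'rV[R]_n.+1).

(** The double sum is added to its transpose, so that only anticommutators of generators occur;
    these vanish off the diagonal. *)
Lemma one_vector_sq u : one_vector u * one_vector u = - (sqnorm u)%:A.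
Proof.
have two : (2 : R) != 0 by rewrite pnatr_eq0.
apply: (scalerI two); rewrite scaler_nat mulr2n.
have E : one_vector u * one_vector u =
    \sum_(i < n) \sum_(j < n) (u 0 i * u 0 j) *: (cl_gen R i * cl_gen R j).
  rewrite /one_vector mulr_suml; apply: eq_bigr => i _.
  rewrite mulr_sumr; apply: eq_bigr => j _.
  by rewrite -scalerAl -scalerAr scalerA.
have E2 := E; rewrite exchange_big /= in E2.
rewrite {1}E E2 -big_split /= /sqnorm scalerN scaler_suml.
rewrite scaler_sumr -sumrN; apply: eq_bigr => i _.
rewrite -big_split /= (bigD1 i) //= big1 ?addr0.
  rewrite -scalerDr cl_genM eqxx scalerN -expr2 scalerA mulrC -scalerA.
  by rewrite -scaler_nat !scalerA; congr (- (_ *: _)); rewrite expr2.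
move=> j ji; rewrite [u 0 j * _]mulrC -scalerDr cl_genM.
by rewrite eq_sym (negPf ji) mul0rn oppr0 scaler0.
Qed.

Lemma sqnorm_vec_part x : sqnorm x = x 0 0 ^+ 2 + sqnorm (vec_part x).
Proof.
rewrite /sqnorm big_ord_recl; congr (_ + _).
by apply: eq_bigr => i _; rewrite mxE.
Qed.

Lemma sqnorm_ge0 k (u : 'rV[R]_k) : 0 <= sqnorm u.
Proof. by apply: sumr_ge0 => i _; apply: sqr_ge0. Qed.

Lemma sqnorm_eq0 k (u : 'rV[R]_k) : sqnorm u = 0 -> u = 0.
Proof.
move=> /eqP; rewrite psumr_eq0; last by move=> i _; apply: sqr_ge0.
move=> /allP u0; apply/rowP => i; apply/eqP.
by rewrite mxE -sqrf_eq0 (implyP (u0 i _)) ?mem_index_enum.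
Qed.

Lemma one_vector_scale c u : one_vector (c *: u) = c *: one_vector u.
Proof.
rewrite /one_vector scaler_sumr; apply: eq_bigr => i _.
by rewrite mxE scalerA.
Qed.

Lemma sqnormZ k c (u : 'rV[R]_k) : sqnorm (c *: u) = c ^+ 2 * sqnorm u.
Proof.
by rewrite /sqnorm mulr_sumr; apply: eq_bigr => i _; rewrite mxE exprMn.
Qed.

Definition shifted s x : clifford R n := paravector s - (x 0 0)%:A.

Lemma paravectorB_conj s x :
  paravector s - paravector_conj x = shifted s x + one_vector (vec_part x).
Proof. by rewrite /shifted /paravector_conj opprB addrA addrAC. Qed.

Lemma sqrrBA (a : clifford R n) (c : R) :
  (a - c%:A) ^+ 2 = a ^+ 2 - (2 * c) *: a + (c ^+ 2)%:A.
Proof.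
rewrite !expr2 mulrBl !mulrBr mulr_algl mulr_algr -scalerAl mul1r scalerA.
move: (a * a) (1 : clifford R n) => b u.
(* Both sides being linear in b and u, compare coordinates. *)
by apply/ffunP => A; rewrite !ffunE /GRing.scale /=; ring.
Qed.

Lemma Qc_shifted s x :
  Qc s x = shifted s x ^+ 2 + (sqnorm (vec_part x))%:A.
Proof.
rewrite /Qc /shifted sqrrBA sqnorm_vec_part.
by rewrite scalerDl addrA.
Qed.

(* The vector part w of s squares to -|w|^2, so that Q_{c,s}(x) lies in
   R + R w, where it is inverted as in the complex numbers. *)
Definition Qc_re s x : R :=
  s 0 0 ^+ 2 - sqnorm (vec_part s) - 2 * x 0 0 * s 0 0 + sqnorm x.

Definition Qc_im s x : R := 2 * (s 0 0 - x 0 0).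

(** The squared modulus of Q_{c,s}(x), seen as the complex number [Qc_re] + i |w| [Qc_im]. Its
    non-vanishing is an open condition in x and serves as the working hypothesis from here on. *)
Definition Qc_norm s x : R :=
  Qc_re s x ^+ 2 + Qc_im s x ^+ 2 * sqnorm (vec_part s).

Definition Qc_conj s x : clifford R n :=
  (Qc_re s x)%:A - Qc_im s x *: one_vector (vec_part s).

Lemma Qc_re_im s x :
  Qc s x = (Qc_re s x)%:A + Qc_im s x *: one_vector (vec_part s).
Proof.
(* The paravector s is w - (-s_0). *)
have := sqrrBA (one_vector (vec_part s)) (- s 0 0).
rewrite scaleNr opprK addrC -/(paravector s) /Qc => ->.
rewrite expr2 one_vector_sq /paravector /Qc_re /Qc_im.
move: (one_vector _) (1 : clifford R n) => w u.
by apply/ffunP => A; rewrite !ffunE /GRing.scale /=; ring.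
Qed.

Lemma Qc_mul_conj s x : Qc s x * Qc_conj s x = (Qc_norm s x)%:A.
Proof.
rewrite Qc_re_im /Qc_conj.
set w := one_vector _; set a := Qc_re s x; set b := Qc_im s x.
rewrite mulrBr !mulrDl !mulr_algl !mulr_algr -!scalerAl -!scalerAr.
rewrite one_vector_sq !scalerA -!expr2 scalerN opprD opprK.
by rewrite addrA addrK scalerA -scalerDl.
Qed.

Lemma Qc_conj_mul s x : Qc_conj s x * Qc s x = (Qc_norm s x)%:A.
Proof.
rewrite -Qc_mul_conj Qc_re_im /Qc_conj.
have ab (a : R) (b : clifford R n) : GRing.comm a%:A b.
  by rewrite /GRing.comm mulr_algl mulr_algr.
by apply: commrD; apply: commr_sym; apply: commrB => //; apply: commr_sym.
Qed.

Lemma Qc_invE s x : Qc_norm s x != 0 ->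
  (Qc s x)^-1 = (Qc_norm s x)^-1 *: Qc_conj s x.
Proof.
move=> N0; have E : Qc s x * ((Qc_norm s x)^-1 *: Qc_conj s x) = 1.
  by rewrite -scalerAr Qc_mul_conj scalerA mulVf ?scale1r.
rewrite -[LHS]mulr1 -E mulKr //; apply/asboolP.
exists ((Qc_norm s x)^-1 *: Qc_conj s x); split=> //.
by rewrite -scalerAl Qc_conj_mul scalerA mulVf ?scale1r.
Qed.

Lemma Qc_unit s x : Qc_norm s x != 0 -> Qc s x \is a GRing.unit.
Proof.
move=> N0; apply/asboolP; exists ((Qc_norm s x)^-1 *: Qc_conj s x).
rewrite -scalerAr Qc_mul_conj -scalerAl Qc_conj_mul.
by rewrite scalerA mulVf ?scale1r.
Qed.

(** If the squared modulus vanishes, so do its two non-negative summands; this forces s_0 = x_0 and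
    |w| = |v|, that is, s lies in [x]. *)
Lemma Qc_norm_neq0 s x : (0 < n)%N -> ~ sphere_of x (paravector s) ->
  Qc_norm s x != 0.
Proof.
move=> n0 sx; apply/eqP => N0; apply: sx.
have r0 := sqnorm_ge0 (vec_part s).
have [a0 b0] : Qc_re s x = 0 /\ Qc_im s x ^+ 2 * sqnorm (vec_part s) = 0.
  move/eqP: N0; rewrite /Qc_norm paddr_eq0 ?sqr_ge0 ?(mulr_ge0 (sqr_ge0 _)) //.
  by rewrite sqrf_eq0 => /andP[/eqP ? /eqP ?].
have re : (s 0 0 - x 0 0) ^+ 2 + sqnorm (vec_part x) = sqnorm (vec_part s).
  apply/eqP; rewrite -subr_eq0 -a0 /Qc_re sqnorm_vec_part.
  by apply/eqP; ring.
have sx0 : s 0 0 = x 0 0.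
  move/eqP: b0; rewrite mulf_eq0 sqrf_eq0 mulf_eq0 pnatr_eq0 /= => /orP[|].
    by rewrite subr_eq0 => /eqP.
  (* If w = 0, then [re] writes 0 as a sum of two non-negative terms, whence s_0 = x_0 again. *)
  move=> /eqP r00; move: re; rewrite r00 => /eqP.
  rewrite paddr_eq0 ?sqr_ge0 ?sqnorm_ge0 // sqrf_eq0 subr_eq0.
  by case/andP => /eqP.
have vs : sqnorm (vec_part x) = sqnorm (vec_part s).
  by rewrite -re sx0 subrr expr0n add0r.
rewrite /sphere_of /paravector sx0 vs.
(* The required J is w / |w|; if w = 0, any unit vector will do, and n > 0 supplies one. *)
have [r00|rn0] := eqVneq (sqnorm (vec_part s)) 0.
  exists (one_vector (delta_mx 0 (Ordinal n0))).
    exists (delta_mx 0 (Ordinal n0)) => //.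
    rewrite /sqnorm (bigD1 (Ordinal n0)) //= big1 ?addr0 => [|i /negPf ni].
      by rewrite mxE !eqxx expr1n.
    by rewrite mxE ni andbF expr0n.
  rewrite r00 sqrtr0 scale0r (sqnorm_eq0 r00).
  by rewrite /one_vector big1 // => i _; rewrite mxE scale0r.
have q0 : Num.sqrt (sqnorm (vec_part s)) != 0.
  by rewrite sqrtr_eq0 -ltNge lt_def rn0.
exists (one_vector ((Num.sqrt (sqnorm (vec_part s)))^-1 *: vec_part s)).
  exists ((Num.sqrt (sqnorm (vec_part s)))^-1 *: vec_part s) => //.
  by rewrite sqnormZ exprVn sqr_sqrtr // mulVf.
by rewrite one_vector_scale scalerA mulfV ?scale1r.
Qed.

End CliffordAlgebra.

(** * Partial derivatives of Clifford-valued functions *)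

Section Partials.
Variables (R : realType) (n : nat).
Local Notation V := 'rV[R]_n.+1.
Implicit Types (i : 'I_n.+1) (s x : V) (f g : V -> clifford R n).
Implicit Types (a b : clifford R n).

(** Existence is recorded together with the value: [partial] is a total function, while the sum and
    product rules require differentiability. *)
Definition has_partial i f x a : Prop :=
  forall A, is_derive x (delta_mx 0 i) (fun y => f y A) (a A).

Lemma partial_val i f x a : has_partial i f x a -> partial i f x = a.
Proof. by move=> fa; apply/ffunP => A; rewrite ffunE; case: (fa A). Qed.

Lemma has_partial_eq i f x a b :
  has_partial i f x a -> a = b -> has_partial i f x b.
Proof. by move=> fa <-. Qed.

(** Allows a formula that is valid only near x to be differentiated again. *)
Lemma near_has_partial i f g x a : {near x, f =1 g} ->
  has_partial i f x a -> has_partial i g x a.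
Proof.
move=> fg fa A; apply: near_eq_is_derive (fa A).
by apply: filterS fg => y ->.
Qed.

Lemma has_partial_cst i a x : has_partial i (fun=> a) x 0.
Proof. by move=> A; rewrite ffunE; apply: is_derive_cst. Qed.

Lemma has_partialD i f g x a b : has_partial i f x a -> has_partial i g x b ->
  has_partial i (fun y => f y + g y) x (a + b).
Proof.
move=> fa gb A; rewrite ffunE; have := is_deriveD (fa A) (gb A).
by congr is_derive; apply/funext => y; rewrite ffunE.
Qed.

Lemma is_derive_sumT (I : finType) (F : I -> V -> R) (d : I -> R) (x v : V) :
  (forall j, is_derive x v (F j) (d j)) ->
  is_derive x v (fun y => \sum_j F j y) (\sum_j d j).
Proof.
move=> Fd; elim: (index_enum I) => [|j r IHr].
  by under eq_fun do rewrite big_nil; rewrite big_nil; apply: is_derive_cst.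
by under eq_fun do rewrite big_cons; rewrite big_cons; apply: is_deriveD.
Qed.

Lemma has_partial_sum (I : finType) i (F : I -> V -> clifford R n)
    (d : I -> clifford R n) x : (forall j, has_partial i (F j) x (d j)) ->
  has_partial i (fun y => \sum_j F j y) x (\sum_j d j).
Proof.
move=> Fd A; rewrite sum_ffunE.
have := is_derive_sumT (fun j => Fd j A).
by congr is_derive; apply/funext => y; rewrite sum_ffunE.
Qed.

Lemma has_partialZ i (k : V -> R) f x (dk : R) a :
  is_derive x (delta_mx 0 i) k dk -> has_partial i f x a ->
  has_partial i (fun y => k y *: f y) x (dk *: f x + k x *: a).
Proof.
move=> kd fa A; rewrite !ffunE; have := is_deriveM kd (fa A).
rewrite addrC [X in X + _]mulrC.
by congr is_derive; apply/funext => y; rewrite ffunE.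
Qed.

(** Each coordinate of a product is a finite bilinear sum of coordinates, so the real product rule
    applies termwise; the factors keep their order. *)
Lemma has_partialM i f g x a b : has_partial i f x a -> has_partial i g x b ->
  has_partial i (fun y => f y * g y) x (a * g x + f x * b).
Proof.
move=> fa gb C.
have := is_derive_sumT (fun A => @is_deriveZ _ _ _ _ (cl_sign R A (symdiff A C))
   _ _ _ (is_deriveM (fa A) (gb (symdiff A C)))).
rewrite /(_ *: _) /= !ffunE -big_split /=.
set d := \sum_ _ _; set e := \sum_ _ _; have -> : d = e.
  by apply: eq_bigr => A _; rewrite /GRing.scale /=; ring.
by congr is_derive; apply/funext => y; rewrite ffunE.
Qed.

Lemma has_partial_Zcst i (k : R) f x a : has_partial i f x a ->
  has_partial i (fun y => k *: f y) x (k *: a).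
Proof.
move=> fa; have := has_partialZ (is_derive_cst k x (delta_mx 0 i)) fa.
by rewrite scale0r add0r.
Qed.

Lemma has_partialN i f x a : has_partial i f x a ->
  has_partial i (fun y => - f y) x (- a).
Proof.
move=> fa; have := has_partial_Zcst (-1) fa; rewrite scaleN1r.
by under eq_fun do rewrite scaleN1r.
Qed.

Lemma has_partialB i f g x a b : has_partial i f x a -> has_partial i g x b ->
  has_partial i (fun y => f y - g y) x (a - b).
Proof. by move=> fa gb; apply: has_partialD => //; apply: has_partialN. Qed.

(** Commutation of f(x) with its derivative merges the k Leibniz terms. At k = 0 the truncated
    exponent is multiplied by 0. *)
Lemma has_partialX i f x a k : has_partial i f x a -> GRing.comm (f x) a ->
  has_partial i (fun y => f y ^+ k) x (k%:R *: (a * f x ^+ k.-1)).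
Proof.
move=> fa fxa; elim: k => [|k IHk].
  by rewrite scale0r; under eq_fun do rewrite expr0; apply: has_partial_cst.
under eq_fun do rewrite exprS.
apply: (has_partial_eq (has_partialM fa IHk)) => /=.
case: k {IHk} => [|k]; first by rewrite scale0r mulr0 addr0 scale1r.
rewrite -scalerAr mulrA fxa -mulrA -exprS.
by rewrite -[in RHS]natr1 scalerDl scale1r addrC.
Qed.

Lemma is_derive_coord i j x :
  is_derive x (delta_mx 0 i) (fun y : V => y 0 j) (j == i)%:R.
Proof.
have did : derivable (id : V -> V) x (delta_mx 0 i) by exact: derivable_id.
split; first by move/derivable_mxP: (did) => /(_ 0 j).
have := derive_mx did; rewrite derive_id => /matrixP /(_ 0 j).
by rewrite !mxE eqxx /= => ->.
Qed.

End Partials.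

(** * The families T(p,l) and S(p,l) and their partial derivatives *)

Section Kernel.
Variables (R : realType) (n : nat) (s : 'rV[R]_n.+1).
Local Notation V := 'rV[R]_n.+1.
Implicit Types (x y : V) (i : 'I_n.+1) (j : 'I_n) (p l : nat).

Lemma is_derive_sqnorm i x :
  is_derive x (delta_mx 0 i) (@sqnorm R n.+1) (2 * x 0 i).
Proof.
have := is_derive_sumT (fun j : 'I_n.+1 => is_deriveX 2 (is_derive_coord i j x)).
rewrite (bigD1 i) //= big1 ?addr0 => [|k /negPf ki]; last by rewrite ki scaler0.
by rewrite eqxx /GRing.scale /= mulr1.
Qed.

Lemma is_derive_Qc_re i x : is_derive x (delta_mx 0 i) (Qc_re s)
  (2 * x 0 i - 2 * (ord0 == i)%:R * s 0 0).
Proof.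
have d := is_deriveZ (2 * s 0 0) (is_derive_coord i 0 x).
have := is_deriveD (is_deriveB (is_derive_cst
  (s 0 0 ^+ 2 - sqnorm (vec_part s)) x (delta_mx 0 i)) d) (is_derive_sqnorm i x).
rewrite /GRing.scale /= sub0r [_ + 2 * x 0 i]addrC [2 * s 0 0 * _]mulrAC.
by congr is_derive; apply/funext => y; rewrite /Qc_re [2 * y 0 0 * _]mulrAC.
Qed.

Lemma is_derive_Qc_im i x :
  is_derive x (delta_mx 0 i) (Qc_im s) (- 2 * (ord0 == i)%:R).
Proof.
have d := is_deriveB (is_derive_cst (s 0 0) x (delta_mx 0 i))
  (is_derive_coord i 0 x).
have := is_deriveZ 2 d.
by rewrite /GRing.scale /= sub0r mulrN mulNr.
Qed.

Lemma continuous_Qc_norm : continuous (Qc_norm s).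
Proof.
have cst (c : R) : continuous (fun _ : V => c) by exact: cst_continuous.
have coord k : continuous (fun y : V => y 0 k) by exact: coord_continuous.
have add (f g : V -> R) : continuous f -> continuous g ->
    continuous (fun y => f y + g y).
  by move=> fc gc x; exact: (cvgD (fc x) (gc x)).
have sub (f g : V -> R) : continuous f -> continuous g ->
    continuous (fun y => f y - g y).
  by move=> fc gc x; exact: (cvgB (fc x) (gc x)).
have mul (f g : V -> R) : continuous f -> continuous g ->
    continuous (fun y => f y * g y).
  by move=> fc gc x; exact: (cvgM (fc x) (gc x)).
have sq (f : V -> R) : continuous f -> continuous (fun y => f y ^+ 2).
  by move=> fc; exact: mul.
have sqn : continuous (@sqnorm R n.+1).
  by apply: continuous_big => [|k _]; [exact: add_continuous|exact: sq].
have re : continuous (Qc_re s).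
  apply: (add _ _ (sub _ _ (cst _) _) sqn).
  exact: (mul _ _ (mul _ _ (cst 2) _)).
have im : continuous (Qc_im s) by apply: (mul _ _ (cst 2)); exact: sub.
exact: (add _ _ (sq _ re) (mul _ _ (sq _ im) (cst _))).
Qed.

Lemma near_Qc_norm_neq0 x : Qc_norm s x != 0 ->
  \forall y \near x, Qc_norm s y != 0.
Proof. exact: (cvgr_neq0 (Qc_norm s x) (@continuous_Qc_norm x)). Qed.

Lemma has_partial_shifted i x :
  has_partial i (shifted s) x (- ((ord0 == i)%:R)%:A).
Proof.
apply: (has_partial_eq (has_partialB (has_partial_cst i (paravector s) x)
  (has_partialZ (is_derive_coord i 0 x) (has_partial_cst i 1 x)))).
by rewrite scaler0 addr0 sub0r.
Qed.

Lemma has_partial_vec i x : has_partial i (fun y => one_vector (vec_part y)) x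
  (\sum_(j < n) (lift ord0 j == i)%:R *: cl_gen R j).
Proof.
apply: has_partial_sum => j; under eq_fun do rewrite mxE.
apply: (has_partial_eq
  (has_partialZ (is_derive_coord i _ x) (has_partial_cst i _ x))).
by rewrite scaler0 addr0.
Qed.

Lemma has_partial_Qc i x : has_partial i (Qc s) x
  ((2 * x 0 i)%:A - (2 * (ord0 == i)%:R) *: paravector s).
Proof.
have d0 := is_deriveZ 2 (is_derive_coord i 0 x).
have := has_partialD (has_partialB (has_partial_cst i (paravector s ^+ 2) x)
  (has_partialZ d0 (has_partial_cst i (paravector s) x)))
  (has_partialZ (is_derive_sqnorm i x) (has_partial_cst i 1 x)).
by rewrite !scaler0 !addr0 sub0r addrC.
Qed.

(** Only existence is extracted: near x the inverse is the explicit quotient of [Qc_conj] by the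
    real function [Qc_norm]. *)
Lemma has_partial_Qc_inv_ex i x : Qc_norm s x != 0 ->
  exists a, has_partial i (fun y => (Qc s y)^-1) x a.
Proof.
move=> N0; have dre := is_derive_Qc_re i x; have dim := is_derive_Qc_im i x.
have dN : derivable (Qc_norm s) x (delta_mx 0 i).
  have d := is_deriveM (is_deriveX 2 dim)
    (is_derive_cst (sqnorm (vec_part s)) x _).
  have := @ex_derive _ _ _ _ _ _ _ (is_deriveD (is_deriveX 2 dre) d).
  by congr derivable; apply/funext => y.
have dNV : is_derive x (delta_mx 0 i) (fun y => (Qc_norm s y)^-1)
  ('D_(delta_mx 0 i) (fun y => (Qc_norm s y)^-1) x).
  by apply: derivableP; apply: derivableV.
have dQ := has_partialZ dNV (has_partialB
  (has_partialZ dre (has_partial_cst i 1 x))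
  (has_partialZ dim (has_partial_cst i (one_vector (vec_part s)) x))).
eexists; apply: near_has_partial dQ.
by apply: filterS (near_Qc_norm_neq0 N0) => y /Qc_invE ->.
Qed.

(** Since the derivative exists, Leibniz's rule for Q Q^{-1} = 1 determines it; commutation with q
    gives the closed form. *)
Lemma has_partial_Qc_inv i x (q : clifford R n) : Qc_norm s x != 0 ->
  has_partial i (Qc s) x q -> GRing.comm (Qc s x) q ->
  has_partial i (fun y => (Qc s y)^-1) x (- (q * (Qc s x)^-1 ^+ 2)).
Proof.
move=> N0 dq cq; have [a da] := has_partial_Qc_inv_ex i N0.
have u := Qc_unit N0; apply: (has_partial_eq da).
have : has_partial i (fun y => Qc s y * (Qc s y)^-1) x 0.
  apply: near_has_partial (has_partial_cst i 1 x).
  by apply: filterS (near_Qc_norm_neq0 N0) => y Ny; rewrite divrr ?Qc_unit.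
move/partial_val; rewrite (partial_val (has_partialM dq da)).
move/(congr1 ( *%R (Qc s x)^-1)); rewrite mulr0 mulrDr mulKr // => /eqP.
rewrite addrC addr_eq0 => /eqP ->.
by rewrite expr2 !mulrA -(commrV (commr_sym cq)).
Qed.

Lemma comm_Qc_shifted x : GRing.comm (Qc s x) (shifted s x).
Proof.
rewrite Qc_shifted; apply: commr_sym; apply: commrD; first exact: commrX.
by rewrite /GRing.comm mulr_algl mulr_algr.
Qed.

Definition kerT p l y : clifford R n := Qc_inv_exp s y l * shifted s y ^+ p.

Definition kerS p l y : clifford R n :=
  (paravector s - paravector_conj y) * kerT p l y.

Lemma comm_shifted_Qc_inv_exp l x :
  GRing.comm (shifted s x) (Qc_inv_exp s x l).
Proof. by apply: commrX; apply: commrV; apply/commr_sym/comm_Qc_shifted. Qed.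

Lemma shifted_kerT p l x : shifted s x * kerT p l x = kerT p.+1 l x.
Proof. by rewrite /kerT mulrA comm_shifted_Qc_inv_exp -mulrA -exprS. Qed.

Lemma Qc_kerT p l x : Qc_norm s x != 0 ->
  Qc s x * kerT p l.+1 x = kerT p l x.
Proof.
by move=> N0; rewrite /kerT /Qc_inv_exp mulrA exprS mulrA divrr ?Qc_unit ?mul1r.
Qed.

Lemma kerS_split p l x :
  kerS p l x = kerT p.+1 l x + one_vector (vec_part x) * kerT p l x.
Proof. by rewrite /kerS paravectorB_conj mulrDl shifted_kerT. Qed.

(** Q = sigma^2 + |v|^2 is inserted between sigma + v and T, so v and sigma, which need not commute,
    are never interchanged. *)
Lemma kerS_Qc p l x : Qc_norm s x != 0 ->
  kerS p.+2 l.+1 x + sqnorm (vec_part x) *: kerS p l.+1 x = kerS p l x.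
Proof.
move=> N0; rewrite /kerS -!shifted_kerT -[kerT p l x]Qc_kerT // Qc_shifted.
rewrite [(_ ^+ 2 + _) * _]mulrDl [in RHS]mulrDr expr2 mulr_algl -scalerAr.
by rewrite -[shifted s x * shifted s x * _]mulrA.
Qed.

(** From v^2 = -|v|^2: v (sigma + v) = (sigma + v) sigma - (sigma^2 + |v|^2), and the last bracket
    is Q. *)
Lemma vec_kerS p l x : Qc_norm s x != 0 ->
  one_vector (vec_part x) * kerS p l.+1 x = kerS p.+1 l.+1 x - kerT p l x.
Proof.
move=> N0; rewrite !kerS_split -[kerT p l x]Qc_kerT // Qc_shifted mulrDl mulrDr.
rewrite mulr_algl mulrA one_vector_sq mulNr mulr_algl expr2 -mulrA !shifted_kerT.
by rewrite opprD addrA [kerT _ _ _ + _]addrC addrK.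
Qed.

Lemma has_partial_kerT i p l x (q : clifford R n) : Qc_norm s x != 0 ->
  has_partial i (Qc s) x q -> GRing.comm (Qc s x) q ->
  has_partial i (kerT p l) x
    (- l%:R *: (q * kerT p l.+1 x)
     - (p%:R * (ord0 == i)%:R) *: kerT p.-1 l x).
Proof.
move=> N0 dq cq; have dQ := has_partial_Qc_inv N0 dq cq.
have cQ : GRing.comm (Qc s x)^-1 (- (q * (Qc s x)^-1 ^+ 2)).
  apply: commrN; apply: commrM; first exact/commr_sym/commrV/commr_sym.
  exact: commrX.
have cs : GRing.comm (shifted s x) (- ((ord0 == i)%:R)%:A).
  by apply: commrN; rewrite /GRing.comm mulr_algl mulr_algr.
apply: (has_partial_eq (has_partialM (has_partialX l dQ cQ)
  (has_partialX p (has_partial_shifted i x) cs))).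
congr (_ + _); last first.
  by rewrite -scalerAr mulNr mulr_algl mulrN -scalerAr scalerN scalerA.
rewrite scaleNr mulNr scalerN mulNr; congr (- _); case: l => [|l].
  by rewrite !scale0r mul0r.
by rewrite -scalerAl -[q * _ * _]mulrA -exprD -[q * _ * _]mulrA.
Qed.

Lemma has_partial0_kerT p l x : Qc_norm s x != 0 ->
  has_partial ord0 (kerT p l) x
    ((2 * l%:R) *: kerT p.+1 l.+1 x - p%:R *: kerT p.-1 l x).
Proof.
(* The x_0-derivative of Q is 2 x_0 - 2 s = -2 sigma. *)
move=> N0; have E : (2 * x 0 0)%:A - (2 * (ord0 == ord0 :> 'I_n.+1)%:R) *:
    paravector s = - 2 *: shifted s x.
  by rewrite eqxx mulr1 scaleNr scalerBr opprB scalerA.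
have := has_partial_Qc ord0 x; rewrite E => dq.
apply: (has_partial_eq (has_partial_kerT p l N0 dq _)); last first.
  by rewrite eqxx mulr1 -scalerAl shifted_kerT scalerA mulrNN mulrC.
by rewrite /GRing.comm -scalerAl -scalerAr comm_Qc_shifted.
Qed.

Lemma has_partialS_kerT j p l x : Qc_norm s x != 0 ->
  has_partial (lift ord0 j) (kerT p l) x
    (- (2 * l%:R * x 0 (lift ord0 j)) *: kerT p l.+1 x).
Proof.
move=> N0; have := has_partial_Qc (lift ord0 j) x.
rewrite mulr0 scale0r subr0 => dq.
apply: (has_partial_eq (has_partial_kerT p l N0 dq _)); last first.
  by rewrite mulr0 scale0r subr0 mulr_algl scalerA mulNr mulrCA mulrA.
by rewrite /GRing.comm mulr_algl mulr_algr.
Qed.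

Lemma has_partial_cauchy_num i x :
  has_partial i (fun y => paravector s - paravector_conj y) x
    (- ((ord0 == i)%:R)%:A + \sum_(j < n) (lift ord0 j == i)%:R *: cl_gen R j).
Proof.
under eq_fun do rewrite paravectorB_conj.
exact: has_partialD (has_partial_shifted i x) (has_partial_vec i x).
Qed.

Lemma has_partial0_kerS p l x : Qc_norm s x != 0 ->
  has_partial ord0 (kerS p l) x
    (- kerT p l x + ((2 * l%:R) *: kerS p.+1 l.+1 x - p%:R *: kerS p.-1 l x)).
Proof.
move=> N0; apply: (has_partial_eq
  (has_partialM (has_partial_cauchy_num ord0 x) (has_partial0_kerT p l N0))).
rewrite big1 => [|j _]; last by rewrite scale0r.
by rewrite addr0 scale1r mulN1r mulrBr -!scalerAr.
Qed.

Lemma has_partialS_kerS j p l x : Qc_norm s x != 0 ->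
  has_partial (lift ord0 j) (kerS p l) x
    (cl_gen R j * kerT p l x
     - (2 * l%:R * x 0 (lift ord0 j)) *: kerS p l.+1 x).
Proof.
move=> N0; apply: (has_partial_eq
  (has_partialM (has_partial_cauchy_num _ x) (has_partialS_kerT j p l N0))).
rewrite (bigD1 j) //= eqxx big1 => [|k /negPf kj]; last first.
  by rewrite (inj_eq lift_inj) kj scale0r.
by rewrite scale0r oppr0 add0r addr0 scale1r -scalerAr scaleNr.
Qed.

End Kernel.

(** * The conjugate Dirac operator and the Laplacian on both families *)

Lemma cl_gen_sq (R : comNzRingType) n (j : 'I_n) :
  cl_gen R j * cl_gen R j = -1.
Proof.
rewrite blade_mul symdiffss /cl_sign !big_set1 leqnn scaleN1r.
by congr (- _); apply/ffunP => A; rewrite !ffunE.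
Qed.

Section Dirac.
Variables (R : realType) (n : nat) (s : 'rV[R]_n.+1).
Local Notation V := 'rV[R]_n.+1.
Implicit Types (x y : V) (f g : V -> clifford R n) (a b : clifford R n).
Implicit Types (i : 'I_n.+1) (j : 'I_n) (p l h : nat).

Definition has_conj_dirac f x b : Prop :=
  exists2 a : 'I_n.+1 -> clifford R n, forall i, has_partial i f x (a i) &
    b = a ord0 - \sum_(j < n) cl_gen R j * a (lift ord0 j).

Lemma conj_dirac_val f x b : has_conj_dirac f x b -> conj_dirac f x = b.
Proof.
case=> a fa ->; rewrite /conj_dirac (partial_val (fa _)).
by congr (_ - _); apply: eq_bigr => j _; rewrite (partial_val (fa _)).
Qed.

Lemma near_has_conj_dirac f g x b : {near x, f =1 g} ->
  has_conj_dirac f x b -> has_conj_dirac g x b.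
Proof.
by move=> fg [a fa ->]; exists a => // i; apply: near_has_partial (fa i).
Qed.

Lemma has_conj_diracD f g x a b : has_conj_dirac f x a ->
  has_conj_dirac g x b -> has_conj_dirac (fun y => f y + g y) x (a + b).
Proof.
case=> a' fa ->; case=> b' gb ->.
exists (fun i => a' i + b' i) => [i|]; first exact: has_partialD.
under [in RHS]eq_bigr do rewrite mulrDr.
by rewrite big_split /= opprD addrACA.
Qed.

Lemma has_conj_diracZ (k : R) f x a : has_conj_dirac f x a ->
  has_conj_dirac (fun y => k *: f y) x (k *: a).
Proof.
case=> a' fa ->; exists (fun i => k *: a' i) => [i|].
  exact: has_partial_Zcst.
rewrite scalerBr scaler_sumr; congr (_ - _).
by apply: eq_bigr => j _; rewrite scalerAr.
Qed.

Lemma has_conj_dirac0 x : has_conj_dirac (fun=> 0) x 0.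
Proof.
exists (fun=> 0) => [i|]; first exact: has_partial_cst.
by rewrite big1 ?subr0 // => j _; rewrite mulr0.
Qed.

Lemma has_conj_dirac_sum N (F : nat -> V -> clifford R n)
    (d : nat -> clifford R n) x :
  (forall k, has_conj_dirac (F k) x (d k)) ->
  has_conj_dirac (fun y => \sum_(0 <= k < N) F k y) x (\sum_(0 <= k < N) d k).
Proof.
move=> Fd; elim: N => [|N IHN].
  rewrite big_geq //; under eq_fun do rewrite big_geq //.
  exact: has_conj_dirac0.
rewrite big_nat_recr //=; under eq_fun do rewrite big_nat_recr //=.
exact: has_conj_diracD.
Qed.

Lemma has_conj_dirac_kerT p l x : Qc_norm s x != 0 ->
  has_conj_dirac (kerT s p l) x
    ((2 * l%:R) *: kerS s p l.+1 x - p%:R *: kerT s p.-1 l x).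
Proof.
(* [unlift ord0] separates the x_0-derivative from those in x_1, ..., x_n; the latter assemble v,
   which completes sigma T to S. *)
move=> N0; exists (fun i => if unlift ord0 i is Some j
  then - (2 * l%:R * x 0 (lift ord0 j)) *: kerT s p l.+1 x
  else (2 * l%:R) *: kerT s p.+1 l.+1 x - p%:R *: kerT s p.-1 l x).
  move=> i; case: unliftP => [j|] ->; first exact: has_partialS_kerT.
  exact: has_partial0_kerT.
rewrite unlift_none kerS_split scalerDr addrAC; congr (_ + _).
under eq_bigr do rewrite liftK.
rewrite /one_vector mulr_suml scaler_sumr -sumrN; apply: eq_bigr => j _.
by rewrite mxE -[_ *: cl_gen R j * _]scalerAl -scalerAr scaleNr opprK scalerA.
Qed.

(** The x_0-derivative of the prefactor gives -T, the squares e_j^2 = -1 give +n T, and rewriting v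
    S by [vec_kerS] gives -2l T; the sum is (n - 1 - 2l) T = 2 (h - l) T. *)
Lemma has_conj_dirac_kerS h p l x : n = h.*2.+1 -> Qc_norm s x != 0 ->
  has_conj_dirac (kerS s p l) x
    ((4 * l%:R) *: kerS s p.+1 l.+1 x - p%:R *: kerS s p.-1 l x
     + (2 * (h%:R - l%:R)) *: kerT s p l x).
Proof.
move=> nh N0; exists (fun i => if unlift ord0 i is Some j
  then cl_gen R j * kerT s p l x
       - (2 * l%:R * x 0 (lift ord0 j)) *: kerS s p l.+1 x
  else - kerT s p l x
       + ((2 * l%:R) *: kerS s p.+1 l.+1 x - p%:R *: kerS s p.-1 l x)).
  move=> i; case: unliftP => [j|] ->; first exact: has_partialS_kerS.
  exact: has_partial0_kerS.
rewrite unlift_none; under [in RHS]eq_bigr do rewrite liftK mulrBr mulrA.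
have -> : \sum_(j < n) (cl_gen R j * cl_gen R j * kerT s p l x
    - cl_gen R j * ((2 * l%:R * x 0 (lift ord0 j)) *: kerS s p l.+1 x))
  = - (n%:R *: kerT s p l x)
    - (2 * l%:R) *: (one_vector (vec_part x) * kerS s p l.+1 x).
  rewrite sumrB; congr (_ - _).
    rewrite (eq_bigr (fun=> - kerT s p l x)) => [|j _].
      by rewrite sumr_const card_ord mulNrn scaler_nat.
    by rewrite cl_gen_sq mulN1r.
  rewrite /one_vector mulr_suml scaler_sumr; apply: eq_bigr => j _.
  by rewrite mxE -[_ *: cl_gen R j * _]scalerAl -scalerAr scalerA.
rewrite vec_kerS //.
have -> : n%:R = 2 * h%:R + 1 :> R by rewrite nh -natr1 -mul2n natrM.
move: (kerS s p.+1 _ x) (kerS s p.-1 _ x) (kerT _ _ _ _) => a b c.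
by apply/ffunP => A; rewrite !ffunE /GRing.scale /=; ring.
Qed.

(** The formula for f is assumed on the whole open set where [Qc_norm] is non-zero, and the
    conclusion holds there too, so the lemma can be iterated. *)
Lemma laplacian_kerS h l x (c : R) f : n = h.*2.+1 ->
  (forall y, Qc_norm s y != 0 -> f y = c *: kerS s 0 l y) ->
  Qc_norm s x != 0 ->
  laplacian f x = (c * (4 * l%:R * (l%:R - 1 - h%:R))) *: kerS s 0 l.+1 x.
Proof.
move=> nh fE N0.
(* First derivatives are identified on a neighbourhood of x, so that second ones can be taken. *)
have part i (F : V -> clifford R n) : (forall y, Qc_norm s y != 0 ->
    has_partial i (kerS s 0 l) y (F y)) ->
    {near x, (fun y => c *: F y) =1 partial i f}.
  move=> dF; apply: filterS (near_Qc_norm_neq0 N0) => y Ny; symmetry.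
  apply: partial_val; apply: near_has_partial (has_partial_Zcst c (dF y Ny)).
  by apply: filterS (near_Qc_norm_neq0 Ny) => z /fE.
have p0 : partial ord0 (partial ord0 f) x =
    c *: ((4 * l%:R * (l%:R + 1)) *: kerS s 2 l.+2 x
   - (4 * l%:R) *: kerT s 1 l.+1 x - (2 * l%:R) *: kerS s 0 l.+1 x).
  apply: partial_val; apply: near_has_partial
    (part _ _ (fun y => @has_partial0_kerS _ _ _ _ _ y)) _.
  apply: has_partial_Zcst; apply: has_partial_eq (has_partialD
    (has_partialN (has_partial0_kerT 0 l N0)) (has_partialB
      (has_partial_Zcst _ (has_partial0_kerS 1 l.+1 N0))
      (has_partial_Zcst _ (has_partial0_kerS 0 l N0)))) _.
  rewrite /= -[l.+1%:R]natr1.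
  rewrite !scale0r scale1r !subr0.
  move: (kerS s 2 _ _) (kerS s 0 _ _) (kerT s 1 _ _) => u v w.
  by apply/ffunP => A; rewrite !ffunE /GRing.scale /=; ring.
have pS j : partial (lift ord0 j) (partial (lift ord0 j) f) x =
    c *: ((4 * l%:R * (l%:R + 1) * x 0 (lift ord0 j) ^+ 2) *: kerS s 0 l.+2 x
   - (4 * l%:R * x 0 (lift ord0 j)) *: (cl_gen R j * kerT s 0 l.+1 x)
   - (2 * l%:R) *: kerS s 0 l.+1 x).
  have dk : is_derive x (delta_mx 0 (lift ord0 j))
      (fun y : V => 2 * l%:R * y 0 (lift ord0 j)) (2 * l%:R).
    have := is_deriveZ (2 * l%:R)
      (is_derive_coord (lift ord0 j) (lift ord0 j) x).
    by rewrite eqxx /GRing.scale /= mulr1.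
  apply: partial_val; apply: near_has_partial
    (part _ _ (fun y => @has_partialS_kerS _ _ _ j _ _ y)) _.
  apply: has_partial_Zcst; apply: has_partial_eq (has_partialB
    (has_partialM (has_partial_cst _ (cl_gen R j) x)
      (has_partialS_kerT j 0 l N0))
    (has_partialZ dk (has_partialS_kerS j 0 l.+1 N0))) _.
  rewrite mul0r add0r -scalerAr -[l.+1%:R]natr1.
  move: (cl_gen R j * _) (kerS s 0 _ _) (kerS s 0 _ _) => u v w.
  by apply/ffunP => A; rewrite !ffunE /GRing.scale /=; ring.
rewrite /laplacian big_ord_recl p0 (eq_bigr _ (fun j _ => pS j)) -scaler_sumr.
rewrite -scalerDr -[(c * _) *: _]scalerA; congr (_ *: _).
rewrite !sumrB sumr_const card_ord -scaler_suml -mulr_sumr.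
have -> : \sum_(j < n) x 0 (lift ord0 j) ^+ 2 = sqnorm (vec_part x).
  by apply: eq_bigr => j _; rewrite mxE.
have -> : \sum_(j < n) (4 * l%:R * x 0 (lift ord0 j)) *:
      (cl_gen R j * kerT s 0 l.+1 x)
    = (4 * l%:R) *: (one_vector (vec_part x) * kerT s 0 l.+1 x).
  rewrite /one_vector mulr_suml scaler_sumr; apply: eq_bigr => j _.
  by rewrite mxE -[_ *: cl_gen R j * _]scalerAl scalerA.
rewrite -(kerS_Qc 0 l.+1 N0) -[_ *+ n]scaler_nat.
have -> : n%:R = 2 * h%:R + 1 :> R by rewrite nh -natr1 -mul2n natrM.
(* Everything is now expressed through S(2,l+2), S(0,l+2) and T(1,l+1), using S(0,l+1) = T(1,l+1) +
   v T(0,l+1). *)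
have -> : one_vector (vec_part x) * kerT s 0 l.+1 x = kerS s 2 l.+2 x
    + sqnorm (vec_part x) *: kerS s 0 l.+2 x - kerT s 1 l.+1 x.
  by rewrite kerS_Qc // kerS_split addrAC subrr add0r.
move: (kerS s 2 _ _) (kerS s 0 _ _) (kerT s 1 _ _) => u v w.
by apply/ffunP => A; rewrite !ffunE /GRing.scale /=; ring.
Qed.

End Dirac.

(** * Recurrences for the coefficients and their binomial form *)

Section Coefficients.
Variable R : realType.
Implicit Types (a : R) (h m u d b : nat).

(** The argument is real because h - m - 1 - u can be negative. *)
Definition falling a d : R := \prod_(0 <= t < d) (a - t%:R).

Lemma falling_recr a d : falling a d.+1 = falling a d * (a - d%:R).
Proof. by rewrite /falling big_nat_recr. Qed.

Lemma falling_recl a d : falling a d.+1 = a * falling (a - 1) d.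
Proof.
rewrite /falling big_nat_recl //= subr0; congr (_ * _).
by apply: eq_bigr => t _; rewrite -natr1; ring.
Qed.

(** The product (q+1) ... (q+d), read backwards, is p (p-1) ... (p-d+1), whatever the sign of q. *)
Lemma binz_falling (p q : int) d : p = q + d%:Z ->
  binz R p q = falling p%:~R d / d`!%:R.
Proof.
move=> ->; rewrite /binz addrC addKr absz_nat mulrC; congr (_ / _).
rewrite big_add1 /= /falling [RHS]big_nat_rev /=; apply: eq_big_nat => l ld.
rewrite add0n addrC intrD -pmulrn natrB //.
by rewrite intrD -pmulrn; ring.
Qed.

(* [kernel_sum b] below is \bar D^(b+1) S(0,m+1). These are the coefficients of
   S(u - d, m + 1 + u), where u + d = b + 1, and of T(u - d, m + 1 + u), where
   u + d = b; the paper's summation index is j = k - d, up to a shift. The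
   binomial vanishes when d > u, which makes the truncated subtraction u - d
   harmless. *)
Definition kerS_coef h m u d : R :=
  4 ^+ u * ((m + u)`!%:R / m`!%:R) * 'C(u, d)%:R
  * falling (h%:R - m%:R - 1 - u%:R) d.

Definition kerT_coef h m u d : R :=
  2 * 4 ^+ u * ((m + u)`!%:R / m`!%:R) * 'C(u, d)%:R
  * falling (h%:R - m%:R - 1 - u%:R) d.+1.

Lemma kerS_coef_small h m u d : (u < d)%N -> kerS_coef h m u d = 0.
Proof. by move=> ud; rewrite /kerS_coef bin_small // mulr0 mul0r. Qed.

Lemma kerT_coef_small h m u d : (u < d)%N -> kerT_coef h m u d = 0.
Proof. by move=> ud; rewrite /kerT_coef bin_small // mulr0 mul0r. Qed.

(** The coefficient of S(u-d, m+2+u) after one more \bar D. Its three sources are S(u-d-1, m+1+u),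
    S(u+1-d, m+2+u) and T(u-d, m+1+u). *)
Lemma kerS_coef_recS h m u d : kerS_coef h m u.+1 d.+1 =
  4 * (m + u.+1)%:R * kerS_coef h m u d.+1
  - (u.+1 - d)%:R * kerS_coef h m u.+1 d
  + 2 * (m + u.+1)%:R * kerT_coef h m u d.
Proof.
(* This absorption identity brings the lowered term to C(u+1,d+1), after which Pascal's rule closes
   the recurrence. *)
have E : (u.+1 - d)%:R * 'C(u.+1, d)%:R = d.+1%:R * 'C(u.+1, d.+1)%:R :> R.
  by rewrite -!natrM mul_bin_left.
rewrite /kerS_coef /kerT_coef -[u.+1%:R]natr1 opprD [_ - 1 + _]addrA.
rewrite falling_recr falling_recl addnS factS natrM exprS.
move: (4 ^+ u) (falling _ d) => q f.
have -> (v w : R) : (u.+1 - d)%:R * (v * 'C(u.+1, d)%:R * w)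
    = v * ((u.+1 - d)%:R * 'C(u.+1, d)%:R) * w by ring.
rewrite E binS natrD -[d.+1%:R]natr1.
by ring.
Qed.

Lemma kerS_coef_rec0 h m u : kerS_coef h m u.+1 0 =
  4 * (m + u.+1)%:R * kerS_coef h m u 0.
Proof.
rewrite /kerS_coef /falling !big_geq // !bin0 !mulr1 addnS factS natrM exprS.
by ring.
Qed.

(** The coefficient of T(u-d-1, m+1+u) after one more \bar D, with sources S(u-d-1, m+1+u) and
    T(u-d, m+1+u). *)
Lemma kerT_coef_recS h m u d : kerT_coef h m u d.+1 =
  2 * (h%:R - (m + u.+1)%:R) * kerS_coef h m u d.+1
  - (u - d)%:R * kerT_coef h m u d.
Proof.
have E : (u - d)%:R * 'C(u, d)%:R = d.+1%:R * 'C(u, d.+1)%:R :> R.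
  by rewrite -!natrM mul_bin_left.
rewrite /kerS_coef /kerT_coef [falling _ d.+2]falling_recr (natrD _ m).
rewrite -[u.+1%:R]natr1.
move: (4 ^+ u) (falling _ _) => q f.
have -> (v w : R) : (u - d)%:R * (v * 'C(u, d)%:R * w)
    = v * ((u - d)%:R * 'C(u, d)%:R) * w by ring.
by rewrite E -[d.+1%:R]natr1; ring.
Qed.

Lemma kerT_coef_rec0 h m u : kerT_coef h m u 0 =
  2 * (h%:R - (m + u.+1)%:R) * kerS_coef h m u 0.
Proof.
rewrite /kerS_coef /kerT_coef falling_recr /falling !big_geq // (natrD _ m).
rewrite -[u.+1%:R]natr1.
by ring.
Qed.

Lemma poch_negS h m : (m < h)%N ->
  poch_neg R h m.+1 = poch_neg R h m * (m%:R - h%:R).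
Proof.
move=> mh; rewrite /poch_neg -[(h - m)%N]prednK ?subn_gt0 // factS natrM.
rewrite prednK ?subn_gt0 // subnS natrB; last exact: ltnW.
have n0 : (h%:R - m%:R : R) != 0.
  by rewrite subr_eq0 eqr_nat gtn_eqF.
have f0 : ((h - m).-1`!%:R : R) != 0 by rewrite pnatr_eq0 -lt0n fact_gt0.
by rewrite exprS; field; rewrite f0 n0.
Qed.

Lemma exp4E k : 4 ^+ k = 2 ^+ (2 * k) :> R.
Proof. by rewrite exprM expr2 -natrM. Qed.

(** With e = u - d, the power 4^u splits as 2^(u+d) 2^e: the first factor is the prefactor 2^beta,
    the second stays in the coefficient. *)
Lemma kerS_coef_binz h m u d e (p q : int) :
  p%:~R = h%:R - m%:R - 1 - u%:R :> R -> p = q + d%:Z -> (d + e = u)%N ->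
  m`!%:R * kerS_coef h m u d =
  2 ^+ (u + d) * (2 ^+ e * (m + u)`!%:R * d`!%:R * 'C(u, e)%:R * binz R p q).
Proof.
move=> pE /binz_falling ->; rewrite pE => du.
rewrite /kerS_coef exp4E.
have -> : 'C(u, e) = 'C(u, d) by rewrite -du -(bin_sub (leq_addl d e)) addnK.
have -> : (2 * u = u + d + e)%N by lia.
have m0 : (m`!%:R : R) != 0 by rewrite pnatr_eq0 -lt0n fact_gt0.
have d0 : (d`!%:R : R) != 0 by rewrite pnatr_eq0 -lt0n fact_gt0.
by rewrite (exprD _ (u + d)); field; rewrite m0 d0.
Qed.

Lemma kerT_coef_binz h m u d e (p q : int) :
  p%:~R = h%:R - m%:R - 1 - u%:R :> R -> p = q + d.+1%:Z -> (d + e = u)%N ->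
  m`!%:R * kerT_coef h m u d =
  2 ^+ (u + d).+1 *
    (2 ^+ e * d.+1`!%:R * (m + u)`!%:R * binz R p q * 'C(u, e)%:R).
Proof.
move=> pE /binz_falling ->; rewrite pE => du.
rewrite /kerT_coef exp4E.
have -> : 'C(u, e) = 'C(u, d) by rewrite -du -(bin_sub (leq_addl d e)) addnK.
have -> : (2 * u = u + d + e)%N by lia.
have m0 : (m`!%:R : R) != 0 by rewrite pnatr_eq0 -lt0n fact_gt0.
have d0 : (d.+1`!%:R : R) != 0 by rewrite pnatr_eq0 -lt0n fact_gt0.
by rewrite exprS (exprD _ (u + d)); field; rewrite m0 d0.
Qed.

(** Here u = k + j + 1 and d = k - j, so that u + d = 2k + 1 is the order beta and u - d = 2j + 1
    the exponent of sigma. The factor m! comes from the iterated Laplacian. *)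
Lemma coef_a1E h m k j : (j <= k)%N ->
  m`!%:R * kerS_coef h m (k + j + 1) (k - j) =
  2 ^+ (2 * k + 1) * coef_a1 R h m k j.
Proof.
move=> jk; rewrite /coef_a1 binz_nat; last by lia.
rewrite (@kerS_coef_binz _ _ _ _ (2 * j + 1)
  (h%:Z - m%:Z - k%:Z - j%:Z - 2) (h%:Z - m%:Z - 2 * k%:Z - 2)); try lia.
  have -> : (k + j + 1 + (k - j) = 2 * k + 1)%N by lia.
  by have -> : (m + (k + j + 1) = m + k + 1 + j)%N by lia.
by rewrite !natrD; ring.
Qed.

Lemma coef_b1E h m k j : (j <= k)%N ->
  m`!%:R * kerT_coef h m (k + j) (k - j) =
  2 ^+ (2 * k + 1) * coef_b1 R h m k j.
Proof.
move=> jk; rewrite /coef_b1 binz_nat; last by lia.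
rewrite (@kerT_coef_binz _ _ _ _ (2 * j)
  (h%:Z - m%:Z - k%:Z - j%:Z - 1) (h%:Z - m%:Z - 2 * k%:Z - 2)); try lia.
  have -> : ((k + j + (k - j)).+1 = 2 * k + 1)%N by lia.
  have -> : ((k - j).+1 = k - j + 1)%N by lia.
  by have -> : (m + (k + j) = m + k + j)%N by lia.
by rewrite !natrD; ring.
Qed.

Lemma coef_a2E h m k j : (j <= k)%N ->
  m`!%:R * kerS_coef h m (k + j) (k - j) =
  2 ^+ (2 * k) * coef_a2 R h m k j.
Proof.
move=> jk; rewrite /coef_a2 binz_nat; last by lia.
rewrite (@kerS_coef_binz _ _ _ _ (2 * j)
  (h%:Z - m%:Z - k%:Z - 1 - j%:Z) (h%:Z - m%:Z - 2 * k%:Z - 1)); try lia.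
  have -> : (k + j + (k - j) = 2 * k)%N by lia.
  by have -> : (m + (k + j) = m + k + j)%N by lia.
by rewrite !natrD; ring.
Qed.

(** Here d = k - j - 1, so that u + d = 2k - 1 = beta - 1 and u - d = 2j + 1. *)
Lemma coef_b2E h m k j : (j < k)%N ->
  m`!%:R * kerT_coef h m (k + j) (k - j.+1) =
  2 ^+ (2 * k) * coef_b2 R h m k j.
Proof.
move=> jk; rewrite /coef_b2 binz_nat; last by lia.
rewrite (@kerT_coef_binz _ _ _ _ (2 * j + 1)
  (h%:Z - m%:Z - k%:Z - 1 - j%:Z) (h%:Z - m%:Z - 2 * k%:Z - 1)); try lia.
  have -> : ((k + j + (k - j.+1)).+1 = 2 * k)%N by lia.
  have -> : ((k - j.+1).+1 = k - j)%N by lia.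
  by have -> : (m + (k + j) = m + k + j)%N by lia.
by rewrite !natrD; ring.
Qed.

End Coefficients.

(** * Reindexing of finite sums *)

Section BigSums.

(** Collects the terms by X d; since a N = 0, the new top term X N carries only a' (N-1). *)
Lemma sum_scaler_shift (R : pzRingType) (W : lmodType R) N (X : nat -> W)
    (a a' : nat -> R) : a N = 0 ->
  \sum_(0 <= d < N) (a d *: X d + a' d *: X d.+1) =
  \sum_(0 <= d < N.+1) (if d is e.+1 then a d + a' e else a 0%N) *: X d.
Proof.
move=> aN; rewrite [RHS]big_nat_recl // big_split /=.
under [in RHS]eq_bigr do rewrite scalerDl.
rewrite big_split addrA /= -(big_nat_recl N 0 (fun d => a d *: X d)) //.
by rewrite big_nat_recr //= aN scale0r addr0.
Qed.

Lemma sum_trunc_rev (W : zmodType) N K (F : nat -> W) : (K <= N)%N ->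
  (forall d, (K <= d < N)%N -> F d = 0) ->
  \sum_(0 <= d < N) F d = \sum_(0 <= j < K) F (K - j.+1)%N.
Proof.
move=> KN F0; rewrite (@big_cat_nat _ _ _ K) //= [X in _ + X]big_nat.
by rewrite [X in _ + X]big1 // addr0 big_nat_rev.
Qed.

End BigSums.

(** * One application of \bar D to the general sum *)

Section Iteration.
Variables (R : realType) (n h m : nat) (s : 'rV[R]_n.+1).
Local Notation V := 'rV[R]_n.+1.
Implicit Types (x y : V) (b d k : nat) (c : R).

(** The range d <= b + 1 grows by one with b, which is the shape produced by [sum_scaler_shift]. *)
Definition kernel_sum b y : clifford R n :=
  \sum_(0 <= d < b.+2)
    (kerS_coef R h m (b.+1 - d) d *: kerS s (b.+1 - 2 * d) (m.+2 + b - d) y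
     + kerT_coef R h m (b - d) d *: kerT s (b - 2 * d) (m.+1 + b - d) y).

Lemma has_conj_dirac_kernel_sum b x : n = h.*2.+1 -> Qc_norm s x != 0 ->
  has_conj_dirac (kernel_sum b) x (kernel_sum b.+1 x).
Proof.
move=> nh N0; have := @has_conj_dirac_sum _ _ b.+2 _ _ x (fun d => has_conj_diracD
  (has_conj_diracZ (kerS_coef R h m (b.+1 - d) d)
    (has_conj_dirac_kerS (b.+1 - 2 * d) (m.+2 + b - d) nh N0))
  (has_conj_diracZ (kerT_coef R h m (b - d) d)
    (has_conj_dirac_kerT (b - 2 * d) (m.+1 + b - d) N0))).
congr has_conj_dirac.
(* [X] and [Y] are the monomials of [kernel_sum b.+1]. The coefficients [a], [t] collect what index
   d sends to d, and [a'], [t'] what it sends to d + 1. *)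
pose X d := kerS s (b.+2 - 2 * d) (m.+3 + b - d) x.
pose Y d := kerT s (b.+1 - 2 * d) (m.+2 + b - d) x.
pose A d := kerS_coef R h m (b.+1 - d) d.
pose B d := kerT_coef R h m (b - d) d.
pose a d := 4 * (m.+2 + b - d)%:R * A d.
pose a' d := 2 * (m.+1 + b - d)%:R * B d - (b.+1 - 2 * d)%:R * A d.
pose t d := 2 * (h%:R - (m.+2 + b - d)%:R) * A d.
pose t' d := - (b - 2 * d)%:R * B d.
have Asmall d : (b.+1 < 2 * d)%N -> A d = 0.
  by move=> bd; apply: kerS_coef_small; lia.
have Bsmall d : (b < 2 * d)%N -> B d = 0.
  by move=> bd; apply: kerT_coef_small; lia.
transitivity (\sum_(0 <= d < b.+2) (a d *: X d + a' d *: X d.+1)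
  + \sum_(0 <= d < b.+2) (t d *: Y d + t' d *: Y d.+1)).
  rewrite -big_split; apply: eq_big_nat => d /andP[_ db].
  (* The exponents differ only when b + 1 - 2d is truncated, and there the coefficient vanishes. *)
  have E1 : A d = 0 \/ kerS s (b.+1 - 2 * d).+1 (m.+2 + b - d).+1 x = X d.
    have [bd|bd] := ltnP b.+1 (2 * d); first by left; exact: Asmall.
    by right; congr (kerS _ _ _ _); lia.
  have E2 : kerS s (b.+1 - 2 * d).-1 (m.+2 + b - d) x = X d.+1.
    by congr (kerS _ _ _ _); lia.
  have E3 : kerS s (b - 2 * d) (m.+1 + b - d).+1 x = X d.+1.
    by congr (kerS _ _ _ _); lia.
  have E4 : kerT s (b - 2 * d).-1 (m.+1 + b - d) x = Y d.+1.
    by congr (kerT _ _ _ _); lia.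
  rewrite /= E2 E3 E4 -/(Y d) /a /a' /t /t' -/(A d) -/(B d).
  case: E1 => [->|->]; move: (X d) (X d.+1) (Y d) (Y d.+1) => u v w z.
    move: (kerS _ _ _ _) => k.
    by apply/ffunP => C; rewrite !ffunE /GRing.scale /=; ring.
  by apply/ffunP => C; rewrite !ffunE /GRing.scale /=; ring.
have A0 : a b.+2 = 0 by rewrite /a Asmall ?mulr0 //; lia.
have T0 : t b.+2 = 0 by rewrite /t Asmall ?mulr0 //; lia.
rewrite !sum_scaler_shift // -big_split /kernel_sum.
apply: eq_big_nat => d /andP[_ db].
have EX : kerS s (b.+2 - 2 * d) (m.+2 + b.+1 - d) x = X d.
  by congr (kerS _ _ _ _); lia.
have EY : kerT s (b.+1 - 2 * d) (m.+1 + b.+1 - d) x = Y d.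
  by congr (kerT _ _ _ _); lia.
rewrite EX EY /=; congr (_ *: _ + _ *: _).
  case: d db {EX EY} => [|d] db.
    by rewrite /a /A !subn0 [RHS]kerS_coef_rec0 !addnS.
  (* At the top index b - d is truncated, so the recurrence does not apply; every coefficient
     involved is 0. *)
  have [->|db'] := eqVneq d b.+1.
    rewrite /a /a' (Asmall b.+2) ?(Asmall b.+1) ?(Bsmall b.+1); try lia.
    by rewrite !mulr0 subr0 addr0 kerS_coef_small //; lia.
  rewrite /a /a' /A /B.
  have -> : (b.+2 - d.+1 = (b - d).+1)%N by lia.
  have -> : (b.+1 - d.+1 = b - d)%N by lia.
  have -> : (b.+1 - d = (b - d).+1)%N by lia.
  have -> : (m.+2 + b - d.+1 = m + (b - d).+1)%N by lia.
  have -> : (m.+1 + b - d = m + (b - d).+1)%N by lia.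
  rewrite kerS_coef_recS.
  have [bd|bd] := ltnP b.+1 (2 * d).
    by rewrite (@kerS_coef_small _ _ _ (b - d).+1 d) ?mulr0; [ring|lia].
  have -> : ((b - d).+1 - d = b.+1 - 2 * d)%N by lia.
  by ring.
case: d db {EX EY} => [|d] db.
  by rewrite /t /A !subn0 kerT_coef_rec0 !addnS.
rewrite /t /t' /A /B.
have -> : (b.+1 - d.+1 = b - d)%N by lia.
rewrite kerT_coef_recS.
have -> : (b - d - d = b - 2 * d)%N by lia.
have [->|db'] := eqVneq d b.+1.
  rewrite !(@kerS_coef_small _ _ _ (b - b.+1)); try lia.
  rewrite ?(@kerT_coef_small _ _ _ (b - b.+1)); try lia.
  by ring.
have -> : (m.+2 + b - d.+1 = m + (b - d).+1)%N by lia.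
by rewrite mulNr.
Qed.

End Iteration.

(** * Closed forms of the iterated operators *)

Section Iterates.
Variables (R : realType) (n h : nat) (s : 'rV[R]_n.+1).
Local Notation V := 'rV[R]_n.+1.
Implicit Types (x y : V) (b m k : nat) (c : R) (f : V -> clifford R n).

(** The step at l = m + 1 contributes 4 (m+1) (m-h), one new factor for each of 4^m, m! and
    (-h)_m. *)
Lemma iter_laplacian_SL_inv m y : n = h.*2.+1 -> (m <= h)%N ->
  Qc_norm s y != 0 ->
  iter m (@laplacian R n) (SL_inv s) y =
  (4 ^+ m * m`!%:R * poch_neg R h m) *: kerS s 0 m.+1 y.
Proof.
move=> nh mh; elim: m mh y => [_ y _|m IHm mh y Ny].
  by rewrite /poch_neg subn0 divff ?pnatr_eq0 -?lt0n ?fact_gt0 // !mulr1 scale1r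
     /kerS /kerT /Qc_inv_exp !expr0 mulr1.
rewrite iterS (laplacian_kerS nh (IHm (ltnW mh))) // poch_negS // factS natrM.
by congr (_ *: _); rewrite exprS -natr1; ring.
Qed.

Lemma kernel_sum0 m y : kernel_sum h m s 0 y =
  (4 * m.+1%:R) *: kerS s 1 m.+2 y
  + (2 * (h%:R - m.+1%:R)) *: kerT s 0 m.+1 y.
Proof.
rewrite /kernel_sum big_nat_recl // big_nat1.
rewrite (@kerS_coef_small _ _ _ (1 - 1) 1) //.
rewrite (@kerT_coef_small _ _ _ (0 - 1) 1) // !scale0r !addr0 !subn0 !addn0.
rewrite kerT_coef_rec0 kerS_coef_rec0.
have -> : kerS_coef R h m 0 0 = 1.
  rewrite /kerS_coef /falling big_geq // addn0 bin0 !mulr1 expr0 mul1r divff //.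
  by rewrite pnatr_eq0 -lt0n fact_gt0.
by rewrite !mulr1 addn1.
Qed.

(** Induction on b over all points with non-zero [Qc_norm], since each \bar D needs the previous
    formula near x; [kernel_sum0] is the base. *)
Lemma iter_conj_dirac b m f c x : n = h.*2.+1 ->
  (forall y, Qc_norm s y != 0 -> f y = c *: kerS s 0 m.+1 y) ->
  Qc_norm s x != 0 ->
  iter b.+1 (@conj_dirac R n) f x = c *: kernel_sum h m s b x.
Proof.
move=> nh fE; elim: b x => [|b IHb] x N0.
  rewrite kernel_sum0 /=; apply: conj_dirac_val.
  apply: (@near_has_conj_dirac _ _ (fun y => c *: kerS s 0 m.+1 y)).
    by apply: filterS (near_Qc_norm_neq0 N0) => y /fE.
  apply: has_conj_diracZ; have := has_conj_dirac_kerS 0 m.+1 nh N0.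
  by rewrite scale0r subr0.
rewrite iterS; apply: conj_dirac_val.
apply: (@near_has_conj_dirac _ _ (fun y => c *: kernel_sum h m s b y)).
  by apply: filterS (near_Qc_norm_neq0 N0) => y /IHb.
by apply: has_conj_diracZ; apply: has_conj_dirac_kernel_sum.
Qed.

(** Coefficients with d > k vanish in both sums; the rest is reversed by d = k - j. *)
Lemma kernel_sum_odd m k x :
  m`!%:R *: kernel_sum h m s (2 * k) x = 2 ^+ (2 * k + 1) *:
    (\sum_(0 <= j < k.+1)
       coef_a1 R h m k j *: kerS s (2 * j + 1) (m + j + 2 + k) x
     + \sum_(0 <= j < k.+1)
         coef_b1 R h m k j *: kerT s (2 * j) (m + 1 + k + j) x).
Proof.
rewrite /kernel_sum big_split scalerDr !scaler_sumr /=.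
rewrite (@sum_trunc_rev _ _ k.+1); try lia; last first.
  by move=> d ?; rewrite kerS_coef_small ?scale0r ?scaler0 //; lia.
rewrite [X in _ + X](@sum_trunc_rev _ _ k.+1); try lia; last first.
  by move=> d ?; rewrite kerT_coef_small ?scale0r ?scaler0 //; lia.
rewrite scalerDr !scaler_sumr.
congr (_ + _); apply: eq_big_nat => j /andP[_ jk]; rewrite !scalerA subSS.
  rewrite -coef_a1E //; congr (_ * kerS_coef _ _ _ _ _ *: kerS _ _ _ _); lia.
rewrite -coef_b1E //; congr (_ * kerT_coef _ _ _ _ _ *: kerT _ _ _ _); lia.
Qed.

(** The S-sum survives for d <= k and the T-sum only for d <= k - 1, which is why the latter has one
    term fewer and uses d = k - j - 1. *)
Lemma kernel_sum_even m k x : (0 < k)%N ->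
  m`!%:R *: kernel_sum h m s (2 * k).-1 x = 2 ^+ (2 * k) *:
    (\sum_(0 <= j < k.+1)
       coef_a2 R h m k j *: kerS s (2 * j) (m + j + 1 + k) x
     + \sum_(0 <= j < k)
         coef_b2 R h m k j *: kerT s (2 * j + 1) (m + 1 + k + j) x).
Proof.
move=> k0; rewrite /kernel_sum big_split scalerDr !scaler_sumr /=.
rewrite (@sum_trunc_rev _ _ k.+1); try lia; last first.
  by move=> d ?; rewrite kerS_coef_small ?scale0r ?scaler0 //; lia.
rewrite [X in _ + X](@sum_trunc_rev _ _ k); try lia; last first.
  by move=> d ?; rewrite kerT_coef_small ?scale0r ?scaler0 //; lia.
rewrite scalerDr !scaler_sumr.
congr (_ + _); apply: eq_big_nat => j /andP[_ jk]; rewrite !scalerA ?subSS.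
  rewrite -coef_a2E //; congr (_ * kerS_coef _ _ _ _ _ *: kerS _ _ _ _); lia.
rewrite -coef_b2E //; congr (_ * kerT_coef _ _ _ _ _ *: kerT _ _ _ _); lia.
Qed.

End Iterates.

Theorem theorem3p11 (R : realType) (n h m beta : nat)
    (n_odd : odd n) (hE : h = ((n - 1) %/ 2)%N)
    (beta_ge1 : (1 <= beta)%N) (m_beta : (m + beta <= h)%N)
    (s x : 'rV[R]_n.+1) (s_x : ~ sphere_of x (paravector s)) :
  (forall k1 : nat, beta = (2 * k1 + 1)%N ->
     iter beta (@conj_dirac R n) (iter m (@laplacian R n) (SL_inv s)) x =
     (2 ^+ beta * 4 ^+ m * poch_neg R h m) *:
       ((paravector s - paravector_conj x)
          * (\sum_(0 <= j < k1.+1) coef_a1 R h m k1 j *: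
               (Qc_inv_exp s x (m + j + 2 + k1)
                * (paravector s - (x 0 0)%:A) ^+ (2 * j + 1)))
        + \sum_(0 <= j < k1.+1) coef_b1 R h m k1 j *:
            (Qc_inv_exp s x (m + 1 + k1 + j)
             * (paravector s - (x 0 0)%:A) ^+ (2 * j))))
  /\
  (forall k2 : nat, (1 <= k2)%N -> beta = (2 * k2)%N ->
     iter beta (@conj_dirac R n) (iter m (@laplacian R n) (SL_inv s)) x =
     (2 ^+ beta * 4 ^+ m * poch_neg R h m) *:
       ((paravector s - paravector_conj x)
          * (\sum_(0 <= j < k2.+1) coef_a2 R h m k2 j *:
               (Qc_inv_exp s x (m + j + 1 + k2)
                * (paravector s - (x 0 0)%:A) ^+ (2 * j)))
        + \sum_(0 <= j < k2) coef_b2 R h m k2 j *: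
            (Qc_inv_exp s x (m + 1 + k2 + j)
             * (paravector s - (x 0 0)%:A) ^+ (2 * j + 1)))).
Proof.
have nh : n = h.*2.+1 by rewrite hE; lia.
have N0 : Qc_norm s x != 0 by apply: Qc_norm_neq0 s_x; lia.
have L y : Qc_norm s y != 0 -> iter m (@laplacian R n) (SL_inv s) y =
    (4 ^+ m * m`!%:R * poch_neg R h m) *: kerS s 0 m.+1 y.
  by apply: iter_laplacian_SL_inv => //; lia.
split=> [k -> | k k0 ->].
  (* In 4^m m! (-h)_m the factor m! is moved next to [kernel_sum], where it is traded for 2^beta. *)
  rewrite {1}addn1 (iter_conj_dirac _ nh L N0) [4 ^+ m * _ * _]mulrAC
    -(scalerA (4 ^+ m * _)) kernel_sum_odd.
  rewrite scalerA mulrC mulrA mulr_sumr; congr (_ *: (_ + _)).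
  by apply: eq_bigr => j _; rewrite -scalerAr.
have E : (2 * k = (2 * k).-1.+1)%N by lia.
rewrite {1}E (iter_conj_dirac _ nh L N0) [4 ^+ m * _ * _]mulrAC
    -(scalerA (4 ^+ m * _)) kernel_sum_even //.
rewrite scalerA mulrC mulrA mulr_sumr; congr (_ *: (_ + _)).
by apply: eq_bigr => j _; rewrite -scalerAr.
Qed.
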